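(* Let $\mathcal{H}$ be a complex Hilbert space, let $T\in\mathcal{L}(\mathcal{H})$ be a Hermitian operator with closed range, and let $T=U_T-V=T^\dagger-W=P_T-Z$ be the polar proper splitting, the MP-proper splitting and the projection proper splitting of $T$, respectively. Then: (1) if the projection proper splitting of $T$ converges, then the polar proper splitting of $T$ converges; moreover, $\rho(U_T^*V)\leq\rho(P_TZ)<1$; (2) if $\|T\|\leq 1$ and the MP-proper splitting of $T$ converges, then the polar proper splitting of $T$ converges; moreover, $\rho(U_T^*V)\leq\rho(TW)<1$; (3) if $\|P_T+T\|\leq 1$ and the projection proper splitting of $T$ converges, then the MP-proper splitting of $T$ converges; moreover, $\rho(TW)\leq\rho(P_TZ)<1$.
   Context: $\rho$ is the spectral radius, $P_T$ the orthogonal projection onto $\mathcal{R}(T)$, $T^\dagger$ the Moore-Penrose inverse, and $T=U_T|T|$ the polar decomposition, with $|T|=(T^*T)^{1/2}$ and $U_T$ the partial isometry with $\mathcal{N}(U_T)=\mathcal{N}(T)$. A proper splitting of a closed range operator $T$ is a decomposition $T=U-V$ with $\mathcal{R}(U)=\mathcal{R}(T)$ and $\mathcal{N}(U)=\mathcal{N}(T)$; it converges if $\rho(U^\dagger V)<1$. The polar, MP- and projection proper splittings of a closed range Hermitian $T$ are those with $U=U_T$, $U=T^\dagger$ and $U=P_T$, respectively; thus $V=U_T-T$, $W=T^\dagger-T$, $Z=P_T-T$, and $U_T^\dagger=U_T^*$, $(T^\dagger)^\dagger=T$, $P_T^\dagger=P_T$. *)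

(* Defs.v *)
From HB Require Import structures.
From mathcomp Require Import all_boot all_order all_algebra.
From mathcomp Require Import sesquilinear complex.
From mathcomp Require Import boolp classical_sets functions reals topology normedtype.

Set Implicit Arguments.
Unset Strict Implicit.
Unset Printing Implicit Defensive.

Import Order.TTheory GRing.Theory Num.Theory.
Import numFieldNormedType.Exports.

Local Open Scope classical_set_scope.
Local Open Scope ring_scope.

(* The inner product is linear in its first argument and conjugate-linear in
   its second one. *)
HB.mixin Record NormedModule_isHilbert (R : realType) H
    of NormedModule R[i] H := {
  inner : {dot H for (@Num.conj R[i])} ;
  innerE : forall x : H, inner x x = `|x| ^+ 2
}.

#[short(type="hilbertType")]
HB.structure Definition Hilbert (R : realType) :=
  {H of NormedModule_isHilbert R H & CompleteNormedModule R[i] H}.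

Section Operators.
Context {R : realType} {H : hilbertType R}.
Implicit Types (A B P T U V X : H -> H) (M : set H) (x y : H).

Definition dot x y : R[i] := inner x y.

Definition bounded_op A : Prop := linear A /\ continuous A.

Definition kernel A : set H := A @^-1` [set 0].

Definition adjoint_of A B : Prop := forall x y, dot (A x) y = dot x (B y).

Definition hermitian_op A : Prop := adjoint_of A A.

Definition positive_op A : Prop :=
  hermitian_op A /\ forall x, 0 <= dot (A x) x.

(* On a normedModType over R[i] the norm takes its values in R[i]; Re recovers
   the real number. *)
Definition opnorm A : R :=
  sup [set complex.Re `|A x| | x in [set x : H | `|x| <= 1]].

Definition spectrum A : set R[i] :=
  [set z | ~ exists S : H -> H,
    [/\ bounded_op S,
        forall x, S (z *: x - A x) = x &
        forall x, z *: S x - A (S x) = x] ].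

(* On the zero space the spectrum is empty and sup gives 0. *)
Definition spectral_radius A : R :=
  sup [set complex.Re `|z| | z in spectrum A].

Definition orth_projection M P : Prop :=
  [/\ bounded_op P, P \o P = P, hermitian_op P & range P = M].

Definition mp_inverse T X : Prop :=
  [/\ bounded_op X, T \o X \o T = T, X \o T \o X = X,
      hermitian_op (T \o X) & hermitian_op (X \o T)].

(* A is |T|, the positive square root of the composite of T^* and T. *)
Definition abs_op T A : Prop :=
  [/\ bounded_op A, positive_op A &
      exists2 B, adjoint_of T B & A \o A = B \o T].

Definition partial_isometry U : Prop :=
  bounded_op U /\
  forall x, (forall y, kernel U y -> dot x y = 0) -> `|U x| = `|x|.

(* U is the partial isometry U_T of the polar decomposition T = U_T |T|. *)
Definition polar_factor T U : Prop :=
  [/\ partial_isometry U, kernel U = kernel T &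
      exists2 A, abs_op T A & T = U \o A].

Definition proper_splitting T U V : Prop :=
  [/\ bounded_op U, bounded_op V, T = U - V, range U = range T &
      kernel U = kernel T].

(* The Moore-Penrose inverse X of U is unique, so the existential only names
   it. *)
Definition convergent_splitting T U V : Prop :=
  proper_splitting T U V /\
  exists2 X, mp_inverse U X & spectral_radius (X \o V) < 1.

Definition polar_splitting T U V : Prop := polar_factor T U /\ T = U - V.

Definition mp_splitting T X W : Prop := mp_inverse T X /\ T = X - W.

Definition projection_splitting T P Z : Prop :=
  orth_projection (range T) P /\ T = P - Z.

End Operators.

(* Main.v *)
(** For a Hermitian operator the spectral radius is the operator norm: the
    spectrum lies in the disc of radius [opnorm A] by the Neumann series, and
    [opnorm A] or [- opnorm A] is in it because [A^2 - (opnorm A)^2] is not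
    bounded below.  With [A = |T|], the three iteration operators are
    [P - A], [P - T^2] and [P - T], so it is enough to compare their norms, and
    this can be done pointwise:
    - [|(P - A) x| <= |(P - T) x|] because [T <= A], an instance of Reid's
      inequality, applied to [T = A U_T^*];
    - [|(P - A) x| <= |(P - T^2) x|] because [P - T^2 = (1 + A) (P - A)] and
      [1 + A] does not decrease norms;
    - [|(P - T^2) x| <= |(P - T) x|] when [opnorm (P + T) <= 1] because
      [P - T^2 = (P + T) (P - T)]. *)
From HB Require Import structures.
Require Import Defs.
From mathcomp Require Import all_boot all_order all_algebra.
From mathcomp Require Import sesquilinear complex ring lra.
From mathcomp Require Import boolp classical_sets functions reals topology normedtype.
From mathcomp Require Import sequences.

Set Implicit Arguments.
Unset Strict Implicit.
Unset Printing Implicit Defensive.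

Import Order.TTheory GRing.Theory Num.Theory.
Import numFieldNormedType.Exports.

Local Open Scope classical_set_scope.
Local Open Scope ring_scope.

Local Notation "x %:C" := (real_complex _ x) (format "x %:C").

(** * The real inner product and bounded operators *)

Section RealGeometry.
Context {R : realType} {H : hilbertType R}.
Implicit Types (x y z : H) (a : R).

(* [dot] and the norm take their values in [R[i]]; [ip] and [nm] are their real
   parts, with which inequalities can be decided over the ordered field [R]. *)
Definition ip x y : R := complex.Re (dot x y).

Definition nm x : R := complex.Re `|x|.

Lemma normE x : `|x| = (nm x)%:C.
Proof. by rewrite /nm RRe_real // ger0_real. Qed.

Lemma nm_ge0 x : 0 <= nm x.
Proof. by rewrite -ler0c -normE. Qed.

Lemma nm_eq0 x : nm x = 0 -> x = 0.
Proof. by move=> x0; apply/normr0_eq0; rewrite normE x0. Qed.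

Lemma dotC x y : dot x y = (dot y x)^*.
Proof. by rewrite /dot hermC expr0 mul1r. Qed.

Lemma sqr_nm x : nm x ^+ 2 = ip x x.
Proof.
apply: complexI; rewrite rmorphXn /= -normE -innerE /ip /dot RRe_real //.
by rewrite innerE ger0_real // exprn_ge0.
Qed.

Lemma ipC x y : ip x y = ip y x.
Proof. by rewrite /ip dotC; case: (dot y x). Qed.

Lemma ipDl x y z : ip (x + y) z = ip x z + ip y z.
Proof. by rewrite /ip /dot linearDl raddfD. Qed.

Lemma ipNl x y : ip (- x) y = - ip x y.
Proof. by rewrite /ip /dot linearNl raddfN. Qed.

Lemma ipZl a x y : ip (a%:C *: x) y = a * ip x y.
Proof.
by rewrite /ip /dot linearZl_LR /=; case: (inner x y) => u v /=; ring.
Qed.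

Lemma ipDr x y z : ip x (y + z) = ip x y + ip x z.
Proof. by rewrite ipC ipDl !(ipC _ x). Qed.

Lemma ipNr x y : ip x (- y) = - ip x y.
Proof. by rewrite ipC ipNl ipC. Qed.

Lemma ipZr a x y : ip x (a%:C *: y) = a * ip x y.
Proof. by rewrite ipC ipZl ipC. Qed.

Lemma ip_ge0 x : 0 <= ip x x.
Proof. by rewrite -sqr_nm sqr_ge0. Qed.

Lemma ip_eq0 x : ip x x = 0 -> x = 0.
Proof. by rewrite -sqr_nm => /eqP; rewrite sqrf_eq0 => /eqP /nm_eq0. Qed.

Definition ip_linE := (ipDl, ipNl, ipZl, ipDr, ipNr, ipZr).

Lemma nm_ler x y : (nm x <= nm y) = (ip x x <= ip y y).
Proof. by rewrite -!sqr_nm ler_pXn2r // nnegrE nm_ge0. Qed.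

Lemma nmD x y : nm (x + y) <= nm x + nm y.
Proof. by rewrite -lecR rmorphD /= -!normE ler_normD. Qed.

Lemma nmN x : nm (- x) = nm x.
Proof. by rewrite /nm normrN. Qed.

Lemma nmZ (c : R[i]) x : nm (c *: x) = complex.Re `|c| * nm x.
Proof.
apply: complexI; rewrite -normE normrZ normE rmorphM /=; congr (_ * _).
Qed.

Lemma nm0 : nm 0 = 0.
Proof. by rewrite /nm normr0. Qed.

End RealGeometry.

(** * Linear bounds and the operator norm *)

Section BoundedOperators.
Context {R : realType} {H : hilbertType R}.
Implicit Types (x y z : H) (A B : H -> H).

Section LinearOp.
Context (A : H -> H) (linA : linear A).

Lemma linopD x y : A (x + y) = A x + A y.
Proof. by have := linA 1 x y; rewrite !scale1r. Qed.

Lemma linop0 : A 0 = 0.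
Proof. by apply: (addrI (A 0)); rewrite -linopD !addr0. Qed.

Lemma linopZ (c : R[i]) x : A (c *: x) = c *: A x.
Proof. by have := linA c x 0; rewrite linop0 !addr0. Qed.

Lemma linopB x y : A (x - y) = A x - A y.
Proof. by rewrite linopD -scaleN1r linopZ scaleN1r. Qed.

End LinearOp.

Lemma bounded_opP A : bounded_op A <->
  linear A /\ exists2 M : R, 0 <= M & forall x, nm (A x) <= M * nm x.
Proof.
split=> -[linA].
  pose f : {linear H -> H} := HB.pack A (GRing.isLinear.Build _ _ _ _ A linA).
  move=> cA; split=> //.
  have /linear_boundedP/pinfty_ex_gt0[M M0 hM] : bounded_near f (nbhs 0).
    exact/linear_bounded_continuous.
  have Mr : M = (complex.Re M)%:C by rewrite RRe_real // gtr0_real.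
  exists (complex.Re M); first by rewrite -ler0c -Mr ltW.
  move=> x; have := hM x.
  by rewrite !normE {1}Mr -rmorphM lecR.
move=> [M M0 hM]; split=> //.
pose f : {linear H -> H} := HB.pack A (GRing.isLinear.Build _ _ _ _ A linA).
apply/(linear_bounded_continuous f)/linear_boundedP.
near=> r => x; apply: (@le_trans _ _ (M%:C * `|x|)).
  by rewrite !normE -rmorphM lecR; apply: hM.
rewrite ler_wpM2r //; near: r; apply: nbhs_pinfty_ge.
by rewrite ger0_real // ler0c.
Unshelve. all: by end_near. Qed.

Lemma bounded_op_lin A : bounded_op A -> linear A.
Proof. by case. Qed.

Lemma bounded_op_comp A B : bounded_op A -> bounded_op B -> bounded_op (A \o B).
Proof.
move=> /bounded_opP[lA [M M0 hM]] /bounded_opP[lB [N N0 hN]].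
apply/bounded_opP; split; first by move=> c x y /=; rewrite lB lA.
exists (M * N) => [|x /=]; first by rewrite mulr_ge0.
by rewrite (le_trans (hM _)) // -mulrA ler_wpM2l.
Qed.

Lemma bounded_opD A B : bounded_op A -> bounded_op B -> bounded_op (A + B).
Proof.
move=> /bounded_opP[lA [M M0 hM]] /bounded_opP[lB [N N0 hN]].
apply/bounded_opP; split.
  by move=> c x y; rewrite !fctE lB lA scalerDr addrACA.
exists (M + N) => [|x]; first by rewrite addr_ge0.
by rewrite !fctE (le_trans (nmD _ _)) // mulrDl lerD.
Qed.

Lemma bounded_opB A B : bounded_op A -> bounded_op B -> bounded_op (A - B).
Proof.
move=> bA /bounded_opP[lB [N N0 hN]]; apply: bounded_opD => //.
apply/bounded_opP; split.
  by move=> c x y; rewrite !fctE lB opprD scalerN.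
by exists N => // x; rewrite !fctE nmN.
Qed.

Lemma opnorm_ub A x : bounded_op A -> nm (A x) <= opnorm A * nm x.
Proof.
move=> /bounded_opP[lA [M M0 hM]].
have le1 y : nm y <= 1 -> nm (A y) <= opnorm A.
  move=> y1; apply: ub_le_sup.
    exists M => _ [z /= z1 <-].
    have {}z1 : nm z <= 1 by rewrite -lecR -normE.
    by rewrite (le_trans (hM z)) // ler_piMr.
  by exists y => //=; rewrite normE lecR.
have [/nm_eq0 ->|x0] := eqVneq (nm x) 0.
  by rewrite linop0 // nm0 mulr0.
have xp : 0 < nm x by rewrite lt_neqAle eq_sym x0 nm_ge0.
have nZ (y : H) : nm ((nm x)^-1%:C *: y) = (nm x)^-1 * nm y.
  by rewrite nmZ ger0_norm ?ler0c ?invr_ge0 ?nm_ge0.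
have := le1 ((nm x)^-1%:C *: x).
rewrite linopZ // !nZ mulVf // => /(_ (lexx _)).
by rewrite ler_pdivrMl // mulrC.
Qed.

Lemma opnorm_le A (M : R) : 0 <= M -> (forall x, nm (A x) <= M * nm x) ->
  opnorm A <= M.
Proof.
move=> M0 hM; apply: ge_sup.
  by exists (nm (A 0)); exists 0; rewrite //= normr0.
move=> _ [z /= z1 <-].
have {}z1 : nm z <= 1 by rewrite -lecR -normE.
by rewrite (le_trans (hM z)) // ler_piMr.
Qed.

Lemma opnorm_ge0 A : bounded_op A -> 0 <= opnorm A.
Proof.
move=> bA; have [[x x0]|nx] := pselect (exists x : H, nm x != 0).
  have xp : 0 < nm x by rewrite lt_neqAle eq_sym x0 nm_ge0.
  by have := le_trans (nm_ge0 _) (opnorm_ub x bA); rewrite pmulr_lge0.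
apply: le_trans (nm_ge0 (A 0)) _.
apply: ub_le_sup; last by exists 0; rewrite //= normr0.
exists 0 => _ [x _ <-]; rewrite -/(nm (A x)).
by have [->//|y0] := eqVneq (nm (A x)) 0; case: nx; exists (A x).
Qed.

End BoundedOperators.

(** * The spectral radius of a Hermitian operator *)

Section SpectralRadius.
Context {R : realType} {H : hilbertType R}.
Implicit Types (x y z : H) (A B : H -> H).

(** Completeness makes the series of the [B^k y] converge. Its partial sums satisfy
    [S (n+1) = B (S n) + y], and continuity of [B] carries this to the limit. *)
Lemma neumann_series B (q : R) y : bounded_op B -> 0 <= q < 1 ->
  (forall x, nm (B x) <= q * nm x) -> exists x, B x + y = x.
Proof.
move=> [lB cB] /andP[q0 q1] hB; pose w k := iter k B y.
have q10 : 0 < 1 - q by rewrite subr_gt0.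
have nw k : nm (w k) <= q ^+ k * nm y.
  elim: k => [|k IH]; first by rewrite mul1r.
  by rewrite (le_trans (hB _)) // exprS -mulrA ler_wpM2l.
(* The factor [1 - q] makes the geometric bound telescope, so the induction involves no division. *)
have tail m d : (1 - q) * nm (\sum_(m <= k < m + d) w k) <=
    (q ^+ m - q ^+ (m + d)) * nm y.
  elim: d => [|d IH]; first by rewrite addn0 big_geq // nm0 subrr mulr0 mul0r.
  rewrite addnS big_nat_recr ?leq_addr //=.
  apply: (le_trans (ler_wpM2l (ltW q10) (nmD _ _))).
  rewrite mulrDr (le_trans (lerD IH (ler_wpM2l (ltW q10) (nw _)))) //.
  by rewrite exprS; lra.
have geo0 : geometric ((1 - q)^-1 * nm y) q @ \oo --> 0.
  by apply: cvg_geometric; rewrite ger0_norm.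
have cvw : cvgn (series w).
  apply/cauchy_cvgP/cauchy_seriesP => e e0.
  have er : e = (complex.Re e)%:C by rewrite RRe_real // gtr0_real.
  have {}e0 : 0 < complex.Re e by rewrite -ltcR -er.
  have [N _ hN] : \forall n \near \oo,
      `|geometric ((1 - q)^-1 * nm y) q n| < complex.Re e.
    exact: cvgr0_norm_lt.
  exists ([set n | N <= n], [set n | N <= n])%N; first by split; exists N.
  move=> [m n] [/= Nm Nn]; rewrite normE er ltcR.
  (* The Cauchy criterion ranges over all pairs; for [n < m] the sum is empty. *)
  have [mn|/ltnW nm'] := leqP m n; last by rewrite big_geq ?nm0.
  have := hN _ Nm; rewrite /geometric /= ger0_norm; last first.
    by rewrite !mulr_ge0 ?invr_ge0 ?nm_ge0 ?exprn_ge0 // ltW.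
  apply: le_lt_trans; rewrite -mulrA ler_pdivlMl //.
  have := tail m (n - m)%N; rewrite subnKC // => /le_trans; apply.
  by rewrite mulrC ler_wpM2l ?nm_ge0 // gerBl exprn_ge0.
exists (limn (series w)).
have shift n : series w n.+1 = B (series w n) + y.
  rewrite /series /= big_nat_recl // addrC; congr (_ + _).
  elim: n => [|n IH]; first by rewrite !big_geq // linop0.
  by rewrite !big_nat_recr //= IH linopD.
have c1 : (fun n => series w n.+1) @ \oo --> limn (series w).
  by rewrite (cvg_shiftS (series w)).
have c2 : (fun n => series w n.+1) @ \oo --> B (limn (series w)) + y.
  under eq_fun do rewrite shift.
  by apply: cvgD; [apply: continuous_cvg => //; exact: cB|exact: cvg_cst].
exact: (cvg_unique _ c2 c1).
Qed.

(** If [|z| > M], the Neumann series of [z^-1 A] makes [z - A] surjective, and the lower bound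
    [|z| - M] makes it injective with bounded inverse. *)
Lemma spectrum_le A (M : R) (z : R[i]) : bounded_op A -> 0 <= M ->
  (forall x, nm (A x) <= M * nm x) -> spectrum A z -> complex.Re `|z| <= M.
Proof.
move=> bA M0 hA; move=> Az; rewrite leNgt; apply/negP => Mz; apply: Az.
set r := complex.Re `|z| in Mz.
have r0 : 0 < r by exact: le_lt_trans M0 Mz.
have z0 : z != 0.
  by apply: contraTneq r0; rewrite /r => ->; rewrite normr0 ltxx.
have lA := bounded_op_lin bA.
have zr : complex.Re `|z^-1| = r^-1.
  apply: (mulfI (lt0r_neq0 r0)); rewrite divff ?lt0r_neq0 //.
  have e : (complex.Re `|z|)%:C * (complex.Re `|z^-1|)%:C = 1.
    by rewrite !RRe_real ?normr_real // -normrM divff ?normr1.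
  by apply: complexI; rewrite rmorphM; exact: e.
have lower x : (r - M) * nm x <= nm (z *: x - A x).
  have := nmD (z *: x - A x) (A x); rewrite subrK nmZ -/r.
  by have := hA x; lra.
have surj y : exists x, z *: x - A x = y.
  have bB : bounded_op (fun x => z^-1 *: A x).
    apply/bounded_opP; split.
      by move=> c x x'; rewrite lA scalerDr !scalerA mulrC.
    exists (r^-1 * M); first by rewrite mulr_ge0 // invr_ge0 ltW.
    by move=> x; rewrite nmZ zr -mulrA ler_wpM2l // invr_ge0 ltW.
  have [] := @neumann_series _ (r^-1 * M) (z^-1 *: y) bB.
  - apply/andP; split; last by rewrite ltr_pdivrMl ?mulr1.
    by rewrite mulr_ge0 // invr_ge0 ltW.
  - by move=> x; rewrite nmZ zr -mulrA ler_wpM2l // invr_ge0 ltW.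
  - move=> x hx; exists x.
    by rewrite -{1}hx scalerDr !scalerA divff // !scale1r addrAC subrr add0r.
(* The inverse is chosen pointwise; its linearity is recovered from injectivity. *)
have {surj} [S hS] := choice surj.
have inj x x' : z *: x - A x = z *: x' - A x' -> x = x'.
  move=> e; apply/eqP; rewrite -subr_eq0; apply/eqP/nm_eq0/eqP.
  rewrite eq_le nm_ge0 andbT -(@pmulr_rle0 _ (r - M)) ?subr_gt0 //.
  apply: le_trans (lower _) _; rewrite (linopB lA) scalerBr opprD opprK.
  by rewrite addrACA e addrACA subrr addNr addr0 nm0.
exists S; split=> [|x|x].
- apply/bounded_opP; split.
    move=> c x y; apply: inj; rewrite hS scalerDr (linopD lA) (linopZ lA).
    by rewrite opprD addrACA scalerA mulrC -scalerA -scalerBr !hS.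
  exists (r - M)^-1; first by rewrite invr_ge0 subr_ge0 ltW.
  by move=> y; rewrite -ler_pdivrMl ?invrK ?invr_gt0 ?subr_gt0 // -{2}(hS y).
- exact/inj/hS.
- exact: hS.
Qed.

Lemma spectral_radius_ge0 A : 0 <= spectral_radius A.
Proof.
rewrite /spectral_radius; set S := image _ _.
(* [sup] is 0 on a set that is empty or unbounded above. *)
have [[[r Sr] ubS]|/sup_out ->//] := pselect (has_sup S).
apply: le_trans (ub_le_sup ubS Sr); have [z _ <-] := Sr.
by rewrite -ler0c RRe_real ?normr_real.
Qed.

Lemma spectral_radius_le_opnorm A : bounded_op A ->
  spectral_radius A <= opnorm A.
Proof.
move=> bA; rewrite /spectral_radius; set S := image _ _.
have [->|/set0P S0] := eqVneq S set0; first by rewrite sup0 opnorm_ge0.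
apply: ge_sup => // _ [z Sz <-].
by apply: (spectrum_le bA _ _ Sz) => [|x]; [exact: opnorm_ge0|exact: opnorm_ub].
Qed.

Lemma resolvent_bound A (z : R[i]) : ~ spectrum A z ->
  exists2 M : R, 0 <= M & forall x, nm x <= M * nm (z *: x - A x).
Proof.
move=> /contrapT[S [/bounded_opP[_ [M M0 hM]] hS _]].
by exists M => // x; rewrite -{1}(hS x).
Qed.

(** If [M] exceeded the spectral radius, [M] and [- M] would lie outside the spectrum and
    [A^2 - M^2] would be bounded below. By symmetry of [A] this becomes [|A x|^2 <= (M^2 - d) |x|^2]
    with [d > 0], against [M] being the norm. *)
Lemma opnorm_le_spectral_radius A : bounded_op A -> hermitian_op A ->
  opnorm A <= spectral_radius A.
Proof.
move=> bA hA; have lA := bounded_op_lin bA.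
have ipA x y : ip (A x) y = ip x (A y) by rewrite /ip hA.
set M := opnorm A; rewrite leNgt; apply/negP => rM.
have M0 : 0 < M by apply: le_lt_trans rM; exact: spectral_radius_ge0.
have nspec (z : R[i]) : complex.Re `|z| = M -> ~ spectrum A z.
  move=> zM Az; move: rM; rewrite ltNge => /negP; apply.
  rewrite -zM; apply: ub_le_sup; last by exists z.
  exists M => _ [z' Az' <-].
  by apply: (spectrum_le bA (ltW M0) _ Az') => x; exact: opnorm_ub.
have [|C1 C10 hC1] := @resolvent_bound A M%:C.
  by apply: nspec; rewrite ger0_norm // ler0c ltW.
have [|C2 C20 hC2] := @resolvent_bound A (- M%:C).
  by apply: nspec; rewrite normrN ger0_norm // ler0c ltW.
(* The summand 1 keeps [C] invertible even if [C1 * C2] is 0. *)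
pose C := (C1 * C2) ^+ 2 + 1.
have C0 : 0 < C by rewrite ltr_wpDl // sqr_ge0.
have low x : ip x x <= C * M ^+ 2 * (M ^+ 2 * ip x x - ip (A x) (A x)).
  set u := M%:C *: x - A x; set v := - M%:C *: u - A u.
  have xv : nm x <= (C1 * C2) * nm v.
    by rewrite (le_trans (hC1 x)) // -mulrA ler_wpM2l.
  have vE : v = A (A x) - (M ^+ 2)%:C *: x.
    rewrite /v /u scalerBr (linopB lA) (linopZ lA) !scaleNr scalerA opprK opprB.
    by rewrite addrACA subrr addr0 addrC expr2 rmorphM.
  (* In [|A^2 x - M^2 x|^2] the cross term is [- 2 M^2 |A x|^2] by symmetry, and
     [|A (A x)| <= M |A x|] absorbs half of it. *)
  have vv : ip v v <= M ^+ 2 * (M ^+ 2 * ip x x - ip (A x) (A x)).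
    have := opnorm_ub (A x) bA; rewrite -/M => AAx.
    have {}AAx : ip (A (A x)) (A (A x)) <= M ^+ 2 * ip (A x) (A x).
      by rewrite -!sqr_nm -exprMn ler_pXn2r // nnegrE ?mulr_ge0 ?nm_ge0 // ltW.
    have AA : ip (A (A x)) x = ip (A x) (A x) by rewrite ipA.
    by rewrite vE !ip_linE (ipC x (A (A x))) AA; lra.
  have xxv : ip x x <= (C1 * C2) ^+ 2 * ip v v.
    by rewrite -!sqr_nm -exprMn ler_pXn2r // nnegrE ?mulr_ge0 ?nm_ge0.
  apply: (le_trans xxv); rewrite -mulrA.
  apply: (@le_trans _ _ (C * ip v v)); last by rewrite ler_pM2l.
  by rewrite ler_wpM2r ?ip_ge0 // lerDl.
pose d := (C * M ^+ 2)^-1.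
have d0 : 0 < d by rewrite invr_gt0 mulr_gt0 // exprn_gt0.
have : M <= Num.sqrt (M ^+ 2 - d).
  apply: opnorm_le => [|x]; first exact: sqrtr_ge0.
  rewrite -(@ler_pXn2r _ 2) ?nnegrE ?mulr_ge0 ?sqrtr_ge0 ?nm_ge0 // exprMn.
  rewrite !sqr_nm; apply: (@le_trans _ _ ((M ^+ 2 - d) * ip x x)).
    have := low x; rewrite -ler_pdivrMl ?mulr_gt0 ?exprn_gt0 // -/d; lra.
  rewrite ler_wpM2r ?ip_ge0 //.
  (* [Num.sqrt] vanishes on negative numbers, so the sign of [M ^+ 2 - d] is split here and
     below. *)
  have [h|h] := leP 0 (M ^+ 2 - d); first by rewrite sqr_sqrtr.
  by rewrite (le_trans (ltW h)) // sqr_ge0.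
have [h|h] := leP 0 (M ^+ 2 - d); last by rewrite ltr0_sqrtr // leNgt M0.
rewrite -(@ler_pXn2r _ 2) ?nnegrE ?sqrtr_ge0 ?(ltW M0) // sqr_sqrtr //.
by rewrite lerBrDr gerDl leNgt d0.
Qed.

(** The chain is [rho(A) <= |A| <= |B| <= rho(B)], the last step by symmetry of [B]. It reduces the
    comparison of spectral radii to a pointwise one. *)
Lemma le_spectral_radius A B : bounded_op A -> bounded_op B -> hermitian_op B ->
  (forall x, nm (A x) <= nm (B x)) -> spectral_radius A <= spectral_radius B.
Proof.
move=> bA bB hB AB; apply: le_trans (spectral_radius_le_opnorm bA) _.
apply: le_trans (opnorm_le_spectral_radius bB hB).
apply: opnorm_le => [|x]; first exact: opnorm_ge0.
exact: le_trans (opnorm_ub _ _).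
Qed.

End SpectralRadius.

(** * Inequalities for positive operators *)

Section PositiveForms.
Context {R : realType} {H : hilbertType R}.
Implicit Types (x y : H) (A K : H -> H).

(** The form of [A] is nonnegative at every [s x + t y]. If [c] is nonzero, [s = c] and [t = - b]
    give [c (a c - b^2) >= 0]. *)
Lemma cauchy_schwarz_form A x y : linear A ->
  (forall x y, ip (A x) y = ip x (A y)) -> (forall x, 0 <= ip (A x) x) ->
  ip (A x) y ^+ 2 <= ip (A x) x * ip (A y) y.
Proof.
move=> lA sA pA; set b := ip (A x) y; set a := ip (A x) x; set c := ip (A y) y.
have c0 : 0 <= c by exact: pA.
have quad (s t : R) : 0 <= s ^+ 2 * a + 2 * s * t * b + t ^+ 2 * c.
  have := pA (s%:C *: x + t%:C *: y).
  rewrite (linopD lA) !(linopZ lA) !ip_linE -/a -/c (sA y x) (ipC y) -/b.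
  by congr (0 <= _); ring.
have [c0'|cn0] := eqVneq c 0; last first.
  have cp : 0 < c by rewrite lt_neqAle eq_sym cn0.
  have := quad c (- b); rewrite [X in 0 <= X](_ : _ = c * (a * c - b ^+ 2)).
    by rewrite pmulr_rge0 // subr_ge0.
  by ring.
(* When [c = 0] these values reduce the form to [- b^2], which forces [b = 0]. *)
have := quad b (- (a + 1) / 2); rewrite c0' !mulr0 addr0.
by rewrite [X in 0 <= X](_ : _ = - b ^+ 2) ?oppr_ge0 //; field.
Qed.

Lemma ip_le_nm x y : ip x y <= nm x * nm y.
Proof.
have [h|/ltW h] := leP (ip x y) 0.
  by rewrite (le_trans h) // mulr_ge0 ?nm_ge0.
rewrite -(@ler_pXn2r _ 2) ?nnegrE ?mulr_ge0 ?nm_ge0 // exprMn !sqr_nm.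
by apply: (@cauchy_schwarz_form id) => // z; exact: ip_ge0.
Qed.

(** If [0 < c < b 0], each step multiplies by at least [b n / c], so [b] grows at least linearly
    with increment [d = b 0 - c] and passes [C]. *)
Lemma bounded_supergeometric (b : nat -> R) (c C : R) : 0 <= c ->
  (forall n, b n ^+ 2 <= b n.+1 * c) -> (forall n, b n <= C) -> b 0%N <= c.
Proof.
move=> c0 hb hC; rewrite leNgt; apply/negP => cb.
have [ce0|cn0] := eqVneq c 0.
  have := hb 0%N.
  by rewrite ce0 mulr0 real_leNgt ?num_real // exprn_gt0 // -ce0.
have cp : 0 < c by rewrite lt_neqAle eq_sym cn0.
pose d := b 0%N - c; have d0 : 0 < d by rewrite subr_gt0.
have grow n : c + n.+1%:R * d <= b n.
  elim: n => [|n IH]; first by rewrite mul1r addrC subrK.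
  rewrite -(ler_pM2r cp); apply: le_trans (hb n).
  have n0 : 0 < n.+1%:R * d by rewrite mulr_gt0 ?ltr0n.
  have n1 : d <= n.+1%:R * d by rewrite ler_peMl ?ler1n // ltW.
  have -> : n.+2%:R * d = n.+1%:R * d + d.
    by rewrite [n.+2%:R]mulrSr mulrDl mul1r.
  move: n0 n1 IH; set t := n.+1%:R * d => n0 n1 IH.
  have p : 0 <= c + t by lra.
  (* This suffices because [c (c + t + d) <= (c + t)^2], as [d <= t]. *)
  have : (c + t) ^+ 2 <= b n ^+ 2.
    by rewrite ler_pXn2r // nnegrE (le_trans p).
  nra.
have [n hn] : exists n, C / d < n%:R.
  by exists (Num.truncn (C / d)).+1; exact: truncnS_gt.
have := le_trans (grow n) (hC n); move: hn; rewrite ltr_pdivrMr // => hn.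
rewrite -addn1 natrD mulrDl; lra.
Qed.

(* Reid's inequality: iterate the Cauchy-Schwarz inequality of the form of A
   along A K^(2^n). *)
Lemma reid_inequality A K x : bounded_op A ->
  (forall x y, ip (A x) y = ip x (A y)) -> (forall x, 0 <= ip (A x) x) ->
  (forall x y, ip (A (K x)) y = ip x (A (K y))) ->
  (forall x, nm (K x) <= nm x) -> ip (A (K x)) x <= ip (A x) x.
Proof.
move=> bA sA pA sAK cK; have lA := bounded_op_lin bA.
have sym m y z : ip (A (iter m K y)) z = ip y (A (iter m K z)).
  elim: m y z => [|m IH] y z; first exact: sA.
  by rewrite iterS sAK -sA IH -iterSr.
have cKm m : nm (iter m K x) <= nm x.
  by elim: m => //= m IH; exact: le_trans (cK _) IH.
(* Since [2 ^ 0 = 1], term 0 is the left-hand side; all terms are bounded because the iterates of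
   [K] do not increase norms. *)
apply: (@bounded_supergeometric (fun n => ip (A (iter (2 ^ n) K x)) x) _
  (opnorm A * nm x * nm x)) => [||n]; first exact: pA.
  (* Half of the factors [K] move to the other argument; Cauchy-Schwarz for [K^(2^n) x] and [x] then
     gives the recursion. *)
  move=> n; have -> : ip (A (iter (2 ^ n.+1) K x)) x =
      ip (A (iter (2 ^ n) K x)) (iter (2 ^ n) K x).
    by rewrite expnS mul2n -addnn iterD sym -sA.
  exact: cauchy_schwarz_form.
apply: le_trans (ip_le_nm _ _) _; rewrite ler_wpM2r ?nm_ge0 //.
by rewrite (le_trans (opnorm_ub _ bA)) // ler_wpM2l // opnorm_ge0.
Qed.

End PositiveForms.

(** * Proper splittings of a Hermitian operator *)

Section Adjoints.
Context {R : realType} {H : hilbertType R}.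
Implicit Types (x y : H) (A B : H -> H).

Lemma ip_inj x y : (forall z, ip z x = ip z y) -> x = y.
Proof.
move=> e; apply/eqP; rewrite -subr_eq0; apply/eqP/ip_eq0.
by rewrite ipDr ipNr e subrr.
Qed.

Lemma ip0r x : ip x 0 = 0.
Proof. by rewrite /ip /dot linear0r. Qed.

Lemma congr_at A B x : A = B -> A x = B x.
Proof. by move->. Qed.

Lemma dot_inj x y : (forall z, dot z x = dot z y) -> x = y.
Proof. by move=> e; apply: ip_inj => z; rewrite /ip e. Qed.

Lemma adjoint_ip A B x y : adjoint_of A B -> ip (A x) y = ip x (B y).
Proof. by move=> AB; rewrite /ip AB. Qed.

Lemma adjoint_sym A B : adjoint_of A B -> adjoint_of B A.
Proof. by move=> AB x y; rewrite dotC -AB -dotC. Qed.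

Lemma adjoint_comp A A' B B' : adjoint_of A A' -> adjoint_of B B' ->
  adjoint_of (A \o B) (B' \o A').
Proof. by move=> hA hB x y /=; rewrite hA hB. Qed.

Lemma hermitian_opB A B : hermitian_op A -> hermitian_op B ->
  hermitian_op (A - B).
Proof.
move=> hA hB x y; rewrite !fctE /dot linearBl linearBr.
by congr (_ - _); [exact: hA|exact: hB].
Qed.

(** [|B y|^2] equals [ip (A (B y)) y], which is at most [|B y| |y|]; divide by [|B y|]. *)
Lemma adjoint_contraction A B : adjoint_of A B ->
  (forall x, nm (A x) <= nm x) -> forall y, nm (B y) <= nm y.
Proof.
move=> AB cA y; have [->|B0] := eqVneq (nm (B y)) 0; first exact: nm_ge0.
have Bp : 0 < nm (B y) by rewrite lt_neqAle eq_sym B0 nm_ge0.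
rewrite -(ler_pM2l Bp) -expr2 sqr_nm -(adjoint_ip _ _ AB).
by rewrite (le_trans (ip_le_nm _ _)) // ler_wpM2r ?nm_ge0.
Qed.

Lemma adjoint_linear A B : adjoint_of A B -> linear B.
Proof.
move=> AB c x y; apply: dot_inj => z.
rewrite -AB /dot !linearDr !linearZr_LR.
by congr (_ * _ + _); exact: AB.
Qed.

Lemma bounded_op_contraction A : linear A -> (forall x, nm (A x) <= nm x) ->
  bounded_op A.
Proof.
by move=> lA cA; apply/bounded_opP; split=> //; exists 1 => // x; rewrite mul1r.
Qed.

(** The symmetric idempotents [A X] and [A Y] have the same range, hence coincide, and likewise
    [X A = Y A]; then [X = X A X = Y A X = Y A Y = Y]. *)
Lemma mp_inverse_unique A X Y : mp_inverse A X -> mp_inverse A Y -> X = Y.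
Proof.
move=> [_ AXA XAX hAX hXA] [_ AYA YAY hAY hYA].
have eA (x : H) : A (X x) = A (Y x).
  apply: dot_inj => z.
  have := hAX z x => /= <-.
  have <- : A (Y (A (X z))) = A (X z) by exact: congr_at (X z) AYA.
  have := hAY (A (X z)) x => /= ->.
  have -> : dot (A (X z)) (A (Y x)) = dot z (A (X (A (Y x)))) by exact: hAX.
  by congr (dot z _); exact: congr_at (Y x) AXA.
have eX (x : H) : X (A x) = Y (A x).
  apply: dot_inj => z.
  have <- : X (A (Y (A x))) = X (A x).
    by congr (X _); exact: congr_at x AYA.
  have <- : dot (X (A z)) (Y (A x)) = dot z (X (A (Y (A x)))) by exact: hXA.
  have <- : dot (Y (A (X (A z)))) x = dot (X (A z)) (Y (A x)) by exact: hYA.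
  have -> : A (X (A z)) = A z by exact: congr_at z AXA.
  exact: hYA.
apply: funext => x.
have <- : X (A (X x)) = X x by exact: congr_at x XAX.
rewrite eX eA; exact: congr_at x YAY.
Qed.

End Adjoints.

(** * The orthogonal projection onto the range of [T] *)

Section HermitianWithProjection.
Context {R : realType} {H : hilbertType R} (T P : H -> H).
Context (bT : bounded_op T) (hT : hermitian_op T).
Context (projP : orth_projection (range T) P).
Implicit Types x y : H.

Let lT : linear T := bounded_op_lin bT.
Let bP : bounded_op P. Proof. by case: projP. Qed.
Let lP : linear P := bounded_op_lin bP.
Let hP : hermitian_op P. Proof. by case: projP. Qed.

Lemma proj_idem x : P (P x) = P x.
Proof. by case: projP => _ PP _ _; exact: congr_at x PP. Qed.

Lemma range_proj x : range T (P x).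
Proof. by case: projP => _ _ _ <-; exists x. Qed.

Lemma proj_range y : range T y -> P y = y.
Proof. by case: projP => _ _ _ <- [x _ <-]; rewrite proj_idem. Qed.

Lemma projT x : P (T x) = T x.
Proof. by apply: proj_range; exists x. Qed.

Lemma Tproj x : T (P x) = T x.
Proof. by apply: dot_inj => z; rewrite -hT -hP projT hT. Qed.

(** Each [P z] has the form [T w], and [dot (T w) x = dot w (T x)]: the range of [T] is orthogonal
    to its kernel. *)
Lemma proj_eq0 x : P x = 0 <-> T x = 0.
Proof.
split=> [x0|x0]; first by rewrite -Tproj x0 linop0.
apply: dot_inj => z; rewrite -hP; have [w _ <-] := range_proj z.
by rewrite hT x0 /dot !linear0r.
Qed.

Lemma proj_compl x : P (x - P x) = 0.
Proof. by rewrite (linopB lP) proj_idem subrr. Qed.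

(** Pythagoras: [|x - P x|^2 = |x|^2 - |P x|^2]. *)
Lemma nm_proj x : nm (P x) <= nm x.
Proof.
rewrite nm_ler (adjoint_ip _ _ hP) proj_idem -subr_ge0.
have := ip_ge0 (x - P x); rewrite !ip_linE (ipC (P x) x).
by rewrite [ip (P x) (P x)](adjoint_ip _ _ hP) proj_idem; lra.
Qed.

Lemma mp_inverse_proj : mp_inverse P P.
Proof.
have PP : P \o P = P by apply: funext => x; exact: proj_idem.
by split=> //; rewrite !PP.
Qed.

Lemma proj_comp_compl : P \o (P - T) = P - T.
Proof.
by apply: funext => x; rewrite !fctE (linopB lP) proj_idem projT.
Qed.

(** * The Moore-Penrose inverse and its splitting *)

Section MoorePenrose.
Context (X : H -> H) (mpX : mp_inverse T X).

(** [T X] is symmetric and fixes [P x]; moving both [T X] and [P] across the inner product leaves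
    [P (T (X z))], which is [T (X z)]. *)
Lemma T_mp x : T (X x) = P x.
Proof.
have [_ TXT _ hTX _] := mpX; apply: dot_inj => z.
have [w _ e] := range_proj x.
have -> : P x = T (X (P x)).
  by rewrite -e; exact: esym (congr_at w TXT).
have <- : dot (T (X z)) (P x) = dot z (T (X (P x))) by exact: hTX.
by rewrite -hP projT; symmetry; exact: hTX.
Qed.

(** Writing [P x = T w] and moving [T] across by symmetry reduces the claim to [T X T = T]. *)
Lemma mp_T x : X (T x) = P x.
Proof.
have [_ TXT _ _ hXT] := mpX; apply: dot_inj => z.
rewrite -[in LHS]Tproj; have [w _ e] := range_proj x.
have <- : dot (X (T z)) (P x) = dot z (X (T (P x))) by exact: hXT.
rewrite -e -hT; have -> : T (X (T z)) = T z by exact: congr_at z TXT.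
exact: hT.
Qed.

Lemma proj_mp x : P (X x) = X x.
Proof. by rewrite -mp_T; case: mpX => _ _ XTX _ _; exact: congr_at x XTX. Qed.

Lemma mp_proj x : X (P x) = X x.
Proof. by rewrite -T_mp; case: mpX => _ _ XTX _ _; exact: congr_at x XTX. Qed.

Lemma mp_proper_splitting : proper_splitting T X (X - T).
Proof.
have bX : bounded_op X by case: mpX.
have lX := bounded_op_lin bX.
split; [by []|exact: bounded_opB|by rewrite opprB addrC subrK| |].
  apply/seteqP; split=> [_ [x _ <-]|_ [x _ <-]].
    by rewrite -proj_mp; exact: range_proj.
  by exists (T (T x)) => //; rewrite mp_T projT.
apply/seteqP; split=> x /= x0.
  by apply/proj_eq0; rewrite -T_mp x0 linop0.
by change (X x = 0); rewrite -mp_proj (proj_eq0 x).2 // linop0.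
Qed.

Lemma mp_comp_compl x : (T \o (X - T)) x = P x - T (T x).
Proof. by rewrite /= !fctE (linopB lT) T_mp. Qed.

Lemma nm_mp_splitting x : opnorm (P + T) <= 1 ->
  nm ((T \o (X - T)) x) <= nm ((P - T) x).
Proof.
move=> PT1; rewrite mp_comp_compl !fctE.
have -> : P x - T (T x) = (P + T) (P x - T x).
  by rewrite !fctE (linopB lP) (linopB lT) proj_idem projT Tproj addrA subrK.
apply: le_trans (opnorm_ub _ (bounded_opD bP bT)) _.
by rewrite ler_piMl ?nm_ge0.
Qed.

End MoorePenrose.

(** * The polar factor, its adjoint and its splitting *)

Section Polar.
Context (U A Ua : H -> H).
Context (isoU : partial_isometry U) (kerU : kernel U = kernel T).
Context (absA : abs_op T A) (TUA : T = U \o A) (adjU : adjoint_of U Ua).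

Let lU : linear U. Proof. by case: isoU => -[]. Qed.
Let bA : bounded_op A. Proof. by case: absA. Qed.
Let lA : linear A := bounded_op_lin bA.
Let hA : hermitian_op A. Proof. by case: absA => _ []. Qed.
Let TE x : T x = U (A x). Proof. by rewrite TUA. Qed.

Lemma ker_polar x : U x = 0 <-> T x = 0.
Proof.
have e : kernel U x = kernel T x by rewrite kerU.
by change (kernel U x <-> kernel T x); rewrite e.
Qed.

Lemma abs_ge0 x : 0 <= ip (A x) x.
Proof. by case: absA => _ [_ pA] _; have := pA x; rewrite lecE => /andP[_]. Qed.

(** The adjoint supplied by [abs_op] agrees with [T], as [T] is Hermitian. *)
Lemma sqr_absE x : A (A x) = T (T x).
Proof.
case: absA => _ _ [B TB AB].
have -> : A (A x) = B (T x) by exact: congr_at x AB.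
by apply: dot_inj => z; rewrite -TB hT.
Qed.

Lemma ker_abs x : A x = 0 <-> T x = 0.
Proof.
have e : ip (A x) (A x) = ip (T x) (T x).
  by rewrite (adjoint_ip _ _ hA) sqr_absE -(adjoint_ip _ _ hT).
by split=> x0; apply: ip_eq0; [rewrite -e|rewrite e]; rewrite x0 ip0r.
Qed.

Lemma polar_proj x : U (P x) = U x.
Proof.
apply/eqP; rewrite -subr_eq0 -oppr_eq0 opprB -(linopB lU); apply/eqP.
exact/ker_polar/proj_eq0/proj_compl.
Qed.

Lemma abs_proj x : A (P x) = A x.
Proof.
apply/eqP; rewrite -subr_eq0 -oppr_eq0 opprB -(linopB lA); apply/eqP.
exact/ker_abs/proj_eq0/proj_compl.
Qed.

Lemma proj_abs x : P (A x) = A x.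
Proof. by apply: dot_inj => z; rewrite -hP -hA abs_proj hA. Qed.

(** [U x = U (P x)], and [P x] is orthogonal to the kernel of [U], where [U] is isometric. *)
Lemma nm_polar x : nm (U x) = nm (P x).
Proof.
rewrite -polar_proj /nm; case: isoU => _ -> // y Uy.
rewrite hP (_ : P y = 0) ?/dot ?linear0r //.
exact/proj_eq0/ker_polar.
Qed.

Lemma polar_contraction x : nm (U x) <= nm x.
Proof. by rewrite nm_polar nm_proj. Qed.

(** Polarization of the equality of norms, at [x + y]. *)
Lemma ip_polar x y : ip (U x) (U y) = ip (P x) (P y).
Proof.
have e z : ip (U z) (U z) = ip (P z) (P z) by rewrite -!sqr_nm nm_polar.
have := e (x + y); rewrite (linopD lU) (linopD lP) !ip_linE !e.
by rewrite (ipC (U y)) (ipC (P y)); lra.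
Qed.

Lemma adj_polarK x : Ua (U x) = P x.
Proof.
apply: ip_inj => z; rewrite -(adjoint_ip _ _ adjU) ip_polar.
by rewrite (adjoint_ip _ _ hP) proj_idem.
Qed.

Lemma proj_adj_polar x : P (Ua x) = Ua x.
Proof. by apply: dot_inj => z; rewrite -hP -adjU polar_proj adjU. Qed.

Let lUa : linear Ua := adjoint_linear adjU.

(** The defect [z] lies in the kernel of [T], so [A (Ua z) = 0]. As [A] and [U] have the same
    kernel, [U (Ua z) = 0], hence [Ua z = 0], and [z] is orthogonal to itself. *)
Lemma proj_polar x : P (U x) = U x.
Proof.
set z := U x - P (U x).
have Tz : T z = 0 by exact/proj_eq0/proj_compl.
have Uaz : Ua z = 0.
  apply: ip_eq0; rewrite -(adjoint_ip _ _ adjU).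
  suff -> : U (Ua z) = 0 by rewrite ipC ip0r.
  apply/ker_polar/ker_abs/dot_inj => v.
  by rewrite -hA -adjU -TE hT Tz.
have : ip z z = 0.
  rewrite {1}/z ipDl ipNl (adjoint_ip _ _ adjU) Uaz (adjoint_ip _ _ hP).
  by rewrite proj_compl !ip0r subrr.
by move/ip_eq0/eqP; rewrite subr_eq0 => /eqP.
Qed.

Lemma mp_inverse_polar : mp_inverse U Ua.
Proof.
have adjUa := adjoint_sym adjU.
split.
- exact: bounded_op_contraction (adjoint_contraction adjU polar_contraction).
- by apply: funext => x /=; rewrite adj_polarK polar_proj.
- by apply: funext => x /=; rewrite adj_polarK proj_adj_polar.
- exact: adjoint_comp.
- exact: adjoint_comp.
Qed.

Lemma polar_proper_splitting : proper_splitting T U (U - T).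
Proof.
have bU : bounded_op U by case: isoU.
split; [by []|exact: bounded_opB|by rewrite opprB addrC subrK| |by []].
apply/seteqP; split=> [_ [x _ <-]|_ [x _ <-]].
  by rewrite -proj_polar; exact: range_proj.
by exists (A x).
Qed.

Lemma polar_comp_compl : Ua \o (U - T) = P - A.
Proof.
by apply: funext => x; rewrite /= !fctE (linopB lUa) TE !adj_polarK proj_abs.
Qed.

(** Taking adjoints in [T = U A] gives [A Ua = T], so Reid's inequality applies to the positive [A]
    and the contraction [Ua]. *)
Lemma ip_le_abs x : ip (T x) x <= ip (A x) x.
Proof.
have AUa y : A (Ua y) = T y.
  by apply: dot_inj => z; rewrite -hA -adjU -TE hT.
rewrite -AUa; apply: (@reid_inequality _ _ A Ua) => // [y z|y|y z|y].
- exact: adjoint_ip.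
- exact: abs_ge0.
- by rewrite !AUa; exact: adjoint_ip.
- exact: adjoint_contraction adjU polar_contraction y.
Qed.

Lemma ip_proj_sub (B : H -> H) x : P (B x) = B x -> hermitian_op B ->
  ip (P x - B x) (P x - B x) = ip (P x) (P x) - 2 * ip (B x) x + ip (B x) (B x).
Proof.
move=> PB hB; rewrite !ip_linE (ipC (P x) (B x)).
have -> : ip (B x) (P x) = ip (B x) x by rewrite -(adjoint_ip _ _ hP) PB.
ring.
Qed.

(** Since [|A x| = |T x|], the two expanded squares differ only in their cross terms, which
    [ip_le_abs] compares. *)
Lemma nm_polar_le_proj x : nm ((P - A) x) <= nm ((P - T) x).
Proof.
rewrite nm_ler !fctE !ip_proj_sub ?projT ?proj_abs //.
rewrite (adjoint_ip x (A x) hA) (adjoint_ip x (T x) hT) sqr_absE.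
by have := ip_le_abs x; lra.
Qed.

Lemma nm_polar_le_mp X x : mp_inverse T X ->
  nm ((P - A) x) <= nm ((T \o (X - T)) x).
Proof.
move=> mpX; rewrite mp_comp_compl // !fctE -sqr_absE.
have -> : P x - A (A x) = P x - A x + A (P x - A x).
  by rewrite (linopB lA) abs_proj addrA subrK.
(* In [|u + A u|^2] both the cross term and [|A u|^2] are nonnegative. *)
move: (P x - A x) => u; rewrite nm_ler !ip_linE (ipC u (A u)).
by have := abs_ge0 u; have := ip_ge0 (A u); lra.
Qed.

Lemma convergent_polar_splitting : spectral_radius (Ua \o (U - T)) < 1 ->
  convergent_splitting T U (U - T).
Proof.
move=> r1; split; first exact: polar_proper_splitting.
by exists Ua => //; exact: mp_inverse_polar.
Qed.

End Polar.
End HermitianWithProjection.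

(** * Comparison of the three iteration operators *)

Theorem proposition6p5 (R : realType) (H : hilbertType R)
    (T UT UTa Td P V W Z : H -> H) :
  bounded_op T -> hermitian_op T -> closed (range T) ->
  polar_splitting T UT V -> adjoint_of UT UTa ->
  mp_splitting T Td W ->
  projection_splitting T P Z ->
  [/\ convergent_splitting T P Z ->
        convergent_splitting T UT V /\
        spectral_radius (UTa \o V) <= spectral_radius (P \o Z) < 1,
      opnorm T <= 1 -> convergent_splitting T Td W ->
        convergent_splitting T UT V /\
        spectral_radius (UTa \o V) <= spectral_radius (T \o W) < 1 &
      opnorm (P + T) <= 1 -> convergent_splitting T P Z ->
        convergent_splitting T Td W /\
        spectral_radius (T \o W) <= spectral_radius (P \o Z) < 1].
Proof.
move=> bT hT _ [[isoU kerU [A absA TUA]] TV] adjU [mpT TW] [projP TZ].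
have compl (B C : H -> H) : T = B - C -> C = B - T.
  by move=> ->; rewrite opprB addrC subrK.
rewrite (compl _ _ TV) (compl _ _ TW) (compl _ _ TZ).
have bP : bounded_op P by case: projP.
have hP : hermitian_op P by case: projP.
have bA : bounded_op A by case: absA.
have hA : hermitian_op A by case: absA => _ [].
have bTd : bounded_op Td by case: mpT.
have bPA : bounded_op (P - A) := bounded_opB bP bA.
have bPT : bounded_op (P - T) := bounded_opB bP bT.
have hPT : hermitian_op (P - T) := hermitian_opB hP hT.
have bTW : bounded_op (T \o (Td - T)).
  exact/bounded_op_comp/bounded_opB.
(* In the second claim the norm of this operator is bounded by its spectral radius, which relies on
   symmetry. *)
have hTW : hermitian_op (T \o (Td - T)).
  have -> : T \o (Td - T) = P - (T \o T).
    by apply: funext => x; rewrite (mp_comp_compl bT projP mpT) !fctE.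
  by apply: hermitian_opB => //; exact: (adjoint_comp hT hT).
(* The Moore-Penrose equations are symmetric in the pair, so the iteration operator of the
   MP-splitting is [T \o W]. *)
have mpTd : mp_inverse Td T by case: mpT.
have UE := polar_comp_compl bT hT projP isoU kerU absA TUA adjU.
have convU := convergent_polar_splitting bT hT projP isoU kerU absA TUA adjU.
(* Uniqueness identifies the inverse provided by convergence with [P] itself. *)
have rP : convergent_splitting T P (P - T) ->
    spectral_radius (P \o (P - T)) < 1.
  move=> [_ [X mpX]].
  by rewrite (mp_inverse_unique mpX (mp_inverse_proj projP)).
have PE := proj_comp_compl projP.
split=> [/rP r1|_ [_ [X mpX r1]]|PT1 /rP r1].
- have le : spectral_radius (UTa \o (UT - T)) <= spectral_radius (P \o (P - T)).
    rewrite UE PE; apply: le_spectral_radius => // x.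
    exact: (nm_polar_le_proj bT hT projP isoU kerU absA TUA adjU x).
  by rewrite le r1; split=> //; apply: convU; exact: (le_lt_trans le r1).
- move: r1; rewrite (mp_inverse_unique mpX mpTd) => r1.
  have le : spectral_radius (UTa \o (UT - T)) <=
      spectral_radius (T \o (Td - T)).
    rewrite UE; apply: le_spectral_radius => // x.
    exact: (nm_polar_le_mp bT hT projP absA x mpT).
  by rewrite le r1; split=> //; apply: convU; exact: (le_lt_trans le r1).
- have le : spectral_radius (T \o (Td - T)) <= spectral_radius (P \o (P - T)).
    rewrite PE; apply: le_spectral_radius => // x.
    exact: (nm_mp_splitting bT hT projP mpT x PT1).
  rewrite le r1; split=> //; split.
    exact: (mp_proper_splitting bT hT projP mpT).
  by exists T => //; exact: (le_lt_trans le r1).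
Qed.
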